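(* Let $\Phi:\mathcal P_2(\mathbb R^d)\to\mathbb R\cup\{+\infty\}$ be a proper geodesically convex functional, bounded from below, such that every $\mu\in\operatorname{dom}\Phi$ is absolutely continuous with respect to Lebesgue measure. Let $\mu\in\mathcal P_2(\mathbb R^d)$ and $\varepsilon>0$ be such that $$\Phi(\mu)\le\inf_{\nu\in\mathcal P_2(\mathbb R^d)}\Phi(\nu)+\varepsilon.$$ Let $\lambda>0$ and suppose there exist $\hat\mu\in\mathcal P_2(\mathbb R^d)$ and $\xi\in L^2(\hat\mu)^d$ such that $$\hat\mu\in J^{\Phi}_{\frac{\lambda^2}{\varepsilon}}(\mu)\quad\text{and}\quad \mathfrak t_{\hat\mu}^{\mu}=\operatorname{id}+\frac{\lambda^2}{\varepsilon}\,\xi .$$ Then: (a) $W_2(\mu,\hat\mu)\le\lambda$; (b) $\Phi(\hat\mu)+\dfrac{\lambda^2}{2\varepsilon}\|\xi\|_{L^2(\hat\mu)^d}^2\le\Phi(\mu)$; (c) $\xi\in\partial\Phi(\hat\mu)$; (d) $\|\xi\|_{L^2(\hat\mu)^d}\le\dfrac{\varepsilon}{\lambda}$.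
   Context: $\mathcal P_2(\mathbb R^d)$ is the set of Borel probability measures on $\mathbb R^d$ with finite second moment, with the Wasserstein distance $$W_2(\mu,\nu):=\inf_{\gamma\in\Gamma(\mu,\nu)}\Big(\int_{\mathbb R^d\times\mathbb R^d}|x-y|^2\,d\gamma(x,y)\Big)^{1/2},$$ where $\Gamma(\mu,\nu)$ is the set of couplings of $\mu$ and $\nu$; $\Gamma_o(\mu,\nu)$ denotes the (nonempty) set of couplings attaining the infimum. Constant-speed geodesics in this space are the curves $\gamma(t)=((1-t)\operatorname{proj}_1+t\operatorname{proj}_2)_{\#}\pi$, $t\in[0,1]$, with $\pi\in\Gamma_o(\mu,\nu)$. $\operatorname{dom}\Phi=\{\mu:\Phi(\mu)<+\infty\}$; $\Phi$ is proper if $\operatorname{dom}\Phi\neq\emptyset$. $\Phi$ is geodesically convex if for all $\mu,\nu\in\mathcal P_2(\mathbb R^d)$ there is at least one constant-speed geodesic $\gamma$ with $\gamma(0)=\mu$, $\gamma(1)=\nu$ such that $\Phi(\gamma(t))\le(1-t)\Phi(\mu)+t\Phi(\nu)$ for all $t\in[0,1]$. For $\mu,\nu\in\operatorname{dom}\Phi$ (so both absolutely continuous), $\mathfrak t_\mu^\nu:\mathbb R^d\to\mathbb R^d$ denotes the ($\mu$-a.e. unique) optimal transport map from $\mu$ to $\nu$, i.e. the Borel map with $(\operatorname{id},\mathfrak t_\mu^\nu)_{\#}\mu\in\Gamma_o(\mu,\nu)$. Equalities between such maps are understood $\mu$-a.e. (for $\mathfrak t_{\hat\mu}^{\mu}$,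 $\hat\mu$-a.e.). $L^2(\mu)^d$ is the space of $\mu$-square-integrable Borel vector fields $\mathbb R^d\to\mathbb R^d$. For $\tau>0$, $$J_\tau^\Phi(\mu):=\operatorname*{arg\,min}_{\nu\in\mathcal P_2(\mathbb R^d)}\Big\{\Phi(\nu)+\frac1{2\tau}W_2(\nu,\mu)^2\Big\}.$$ The subdifferential $\partial\Phi(\mu)$ of $\Phi$ at $\mu\in\operatorname{dom}\Phi$ consists of all $\xi\in L^2(\mu)^d$ such that $$\Phi(\nu)\ge\Phi(\mu)+\int_{\mathbb R^d}\langle\xi(x),\mathfrak t_\mu^\nu(x)-x\rangle\,d\mu(x)\qquad\forall\nu\in\mathcal P_2(\mathbb R^d)$$ (the inequality is regarded as trivially true when $\Phi(\nu)=+\infty$). *)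

(* Defs.v *)
From HB Require Import structures.
From mathcomp Require Import all_boot all_order all_algebra.
From mathcomp Require Import all_classical all_reals all_analysis giry.

Set Implicit Arguments.
Unset Strict Implicit.
Unset Printing Implicit Defensive.

Import Order.TTheory GRing.Theory Num.Theory.
Import numFieldNormedType.Exports.

Local Open Scope classical_set_scope.
Local Open Scope ring_scope.

(* R^d is 'rV[R]_d with its Borel sigma-algebra. *)
Section borel_rV.
Context (R : realType) (d : nat).

HB.instance Definition _ := @isMeasurable.Build
  (sigma_display (@open 'rV[R]_d)) 'rV[R]_d
  <<s @open 'rV[R]_d >> (@sigma_algebra0 _ setT (@open 'rV[R]_d))
  (@sigma_algebraC _ (@open 'rV[R]_d))
  (@sigma_algebra_bigcup _ setT (@open 'rV[R]_d)).

End borel_rV.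

Section euclidean.
Context {R : realType} {d : nat}.
Implicit Types x y : 'rV[R]_d.

(* The library norm `|x| on 'rV[R]_d is the sup norm, hence these. *)
Definition inner x y : R := \sum_(i < d) x 0 i * y 0 i.

Definition enorm x : R := Num.sqrt (inner x x).

Definition cbox (a b : 'rV[R]_d) : set 'rV[R]_d :=
  [set x | forall i, a 0 i <= x 0 i <= b 0 i].

(* Lebesgue outer measure; on Borel sets it is the Lebesgue measure.  The
   covers are indexed by a subset D of nat, so that empty and finite covers are
   allowed (in dimension 0 the only box is the whole space, of volume 1). *)
Definition lebesgue_outer (A : set 'rV[R]_d) : \bar R :=
  ereal_inf [set s | exists (D : pred nat) (a b : nat -> 'rV[R]_d),
    [/\ forall k i, a k 0 i <= b k 0 i,
        A `<=` \bigcup_(k in [set` D]) cbox (a k) (b k) &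
        s = (\sum_(0 <= k <oo | D k)
               (\prod_(i < d) (b k 0 i - a k 0 i))%:E)%E]].

End euclidean.

(* Equality of Borel measures is equality on Borel sets: the set functions
   carried by library measures are also defined, with arbitrary values, on
   non-measurable sets. *)
Definition is_pushforward {d1 d2 : measure_display} {T1 : measurableType d1}
    {T2 : measurableType d2} {R : realType}
    (m : set T1 -> \bar R) (f : T1 -> T2) (m' : set T2 -> \bar R) : Prop :=
  forall A, measurable A -> m' A = pushforward m f A.

Section wasserstein.
Local Open Scope ereal_scope.
Context {R : realType} {d : nat}.

Record P2 := MkP2 {
  P2_prob :> probability 'rV[R]_d R ;
  P2_moment : \int[P2_prob]_x (enorm x ^+ 2)%:E < +oo }.

Implicit Types mu nu : P2.

Definition coupling mu nu : set (probability ('rV[R]_d * 'rV[R]_d)%type R) :=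
  [set g | is_pushforward g fst mu /\ is_pushforward g snd nu].

Definition transport_cost (g : probability ('rV[R]_d * 'rV[R]_d)%type R)
    : \bar R :=
  (\int[g]_z (enorm (z.1 - z.2) ^+ 2)%:E) `^ 2^-1.

Definition W2 mu nu : \bar R :=
  ereal_inf [set transport_cost g | g in coupling mu nu].

Definition optimal_coupling mu nu :
    set (probability ('rV[R]_d * 'rV[R]_d)%type R) :=
  [set g | coupling mu nu g /\ transport_cost g = W2 mu nu].

Definition is_geodesic mu nu (c : R -> P2) : Prop :=
  exists2 g, optimal_coupling mu nu g &
    forall t : R, (0 <= t <= 1)%R ->
      is_pushforward g (fun z => (1 - t) *: z.1 + t *: z.2)%R (c t).

Definition is_optimal_map mu nu (T : 'rV[R]_d -> 'rV[R]_d) : Prop :=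
  measurable_fun setT T /\
  exists2 g, optimal_coupling mu nu g & is_pushforward mu (fun x => (x, T x)) g.

(* A chosen optimal map (a representative of the mu-a.e. class when mu is
   absolutely continuous); the default value idfun is only used when there is
   no optimal map. *)
Definition transport_map mu nu : 'rV[R]_d -> 'rV[R]_d :=
  @xget ('rV[R]_d -> 'rV[R]_d) idfun [set T | is_optimal_map mu nu T].

Definition L2norm mu (xi : 'rV[R]_d -> 'rV[R]_d) : \bar R :=
  'N[mu]_2%:E[EFin \o (enorm \o xi)].

Definition L2 mu : set ('rV[R]_d -> 'rV[R]_d) :=
  [set xi | measurable_fun setT xi /\ L2norm mu xi < +oo].

Section functionals.
Implicit Type Phi : P2 -> \bar R.

Definition dom Phi : set P2 := [set mu | Phi mu < +oo].

Definition geodesically_convex Phi : Prop :=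
  forall mu nu, exists2 c, is_geodesic mu nu c &
    forall t : R, (0 <= t <= 1)%R ->
      Phi (c t) <= (1 - t)%:E * Phi mu + t%:E * Phi nu.

Definition prox_energy Phi (tau : R) mu nu : \bar R :=
  Phi nu + (2 * tau)^-1%:E * W2 nu mu ^+ 2.

Definition prox Phi (tau : R) mu : set P2 :=
  [set nu | forall rho, prox_energy Phi tau mu nu <= prox_energy Phi tau mu rho].

Definition subdifferential Phi mu : set ('rV[R]_d -> 'rV[R]_d) :=
  [set xi | [/\ dom Phi mu, L2 mu xi & forall nu, dom Phi nu ->
     Phi mu + \int[mu]_x (inner (xi x) (transport_map mu nu x - x))%:E
       <= Phi nu]].

End functionals.
End wasserstein.

Arguments P2 : clear implicits.

(* Main.v *)
From HB Require Import structures.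
Require Import Defs.
From mathcomp Require Import all_boot all_order all_algebra.
From mathcomp Require Import all_classical all_reals all_analysis giry.
From mathcomp Require Import measurable_realfun ring lra.

(* Write tau = lambda ^ 2 / eps.  If g is an optimal coupling of muhat and nu
   along which Phi is convex and gamma the corresponding geodesic, minimality of
   muhat gives
     Phi(muhat) + W2(muhat, mu)^2 / (2 tau)
       <= (1 - t) Phi(muhat) + t Phi(nu) + W2(gamma t, mu)^2 / (2 tau).
   When g is carried by the graph of the transport map to nu, transporting muhat
   simultaneously to gamma t and to mu bounds W2(gamma t, mu)^2 by the integral
   of |tau xi - t (t_muhat^nu - id)|^2; expanding the square, dividing by t and
   letting t tend to 0 gives (c).  As W2(muhat, mu) = tau ||xi||, taking nu = mu
   in (c) yields Phi(muhat) + tau ||xi||^2 <= Phi(mu) <= Phi(muhat) + eps, from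
   which (a), (b) and (d) follow.

   That every optimal coupling g from an absolutely continuous measure is
   carried by one map is a form of Brenier's theorem.  Exchanging endpoints
   between two independent copies of g shows that the support of g is monotone.
   The points where a monotone set is multivalued form a countable union of
   subsets of Lipschitz graphs, hence a Lebesgue null set.  Uniqueness of g
   follows because the midpoint of two optimal couplings is optimal, hence also
   carried by a graph. *)

Set Implicit Arguments.
Unset Strict Implicit.
Unset Printing Implicit Defensive.

Import Order.TTheory GRing.Theory Num.Theory.
Import numFieldNormedType.Exports.

Local Open Scope classical_set_scope.
Local Open Scope ring_scope.

(** * A countable base of balls in ['rV[R]_d] *)

Section rational_balls.
Context {R : realType} {d : nat}.

Definition rat_ball (b : 'rV[rat]_d * nat) : set 'rV[R]_d :=
  ball (map_mx (@ratr R) b.1) b.2.+1%:R^-1.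

Lemma measurable_rat_ball b : measurable (rat_ball b).
Proof. by apply: sub_sigma_algebra; exact: ball_open. Qed.

(** Each coordinate of [x] is approximated by a rational, within a radius below half that of a ball
    around [x] inside [A]. *)
Lemma nbhs_rat_ball (x : 'rV[R]_d) (A : set 'rV[R]_d) : nbhs x A ->
  exists b, rat_ball b x /\ rat_ball b `<=` A.
Proof.
move=> /nbhs_ballP[e /= e0 xeA].
have [n ne] : exists n : nat, n.+1%:R^-1 < e / 2 :> R.
  by exists (Num.truncn (e / 2)^-1); rewrite invf_plt ?posrE ?divr_gt0// truncnS_gt.
have n0 : 0 < n.+1%:R^-1 :> R by rewrite invr_gt0.
have /choice[c cP] (i : 'I_d) : exists q : rat,
    ratr q \in `]x 0 i - n.+1%:R^-1, x 0 i + n.+1%:R^-1[.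
  by apply: rat_in_itvoo; rewrite ltrBlDr -addrA ltrDl addr_gt0.
have bx : rat_ball (\row_i c i, n) x.
  split=> // i j; rewrite !mxE ord1 -ball_normE /ball_ /=.
  have := cP j; rewrite in_itv/= ltrBlDr ltr_norml => /andP[cl cu].
  by rewrite ltrBlDl cu ltrNl opprB ltrBlDl cl.
exists (\row_i c i, n); split=> // y yb; apply: xeA.
rewrite [e](_ : _ = e / 2 + e / 2); last lra.
apply: (@ball_triangle _ _ (map_mx (@ratr R) (\row_i c i))).
  by apply: ball_sym; exact: (le_ball (ltW ne)).
exact: (le_ball (ltW ne)).
Qed.

End rational_balls.

(** * Borel measurability of vector-valued maps *)

Section borel_measurability.
Context {R : realType} {d : nat}.
Local Notation V := 'rV[R]_d.

Lemma open_measurable_rV (A : set V) : open A -> measurable A.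
Proof. by move=> oA; exact: sub_sigma_algebra. Qed.

Lemma closed_measurable_rV (A : set V) : closed A -> measurable A.
Proof.
move=> cA; rewrite -(setCK A); apply: measurableC; apply: open_measurable_rV.
exact: closed_openC.
Qed.

Lemma compact_measurable_rV (A : set V) : compact A -> measurable A.
Proof.
by move=> cA; apply: closed_measurable_rV; apply: compact_closed.
Qed.

Lemma measurable_coord (i : 'I_d) : measurable_fun setT (fun x : V => x 0 i).
Proof.
apply: (measurability _ (RGenOInfty.measurableE R)) => _ [_ [x ->] <-].
rewrite setTI; apply: open_measurable_rV.
by apply: open_comp => // y _; exact: coord_continuous.
Qed.

(** An open set is a countable union of rational balls, and a ball of the sup norm constrains each
    coordinate separately, so its preimage is a finite intersection of measurable sets. *)
Lemma measurable_fun_rV {disp} {T : measurableType disp} (f : T -> V) :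
  (forall i, measurable_fun setT (fun t => f t 0 i)) -> measurable_fun setT f.
Proof.
move=> mf; apply: (measurability (@open V)) => // _ [U oU <-]; rewrite setTI.
have -> : U = \bigcup_(b in [set b | rat_ball b `<=` U]) rat_ball b.
  apply/seteqP; split=> [x Ux|x [b bU] bx]; last exact: bU.
  by have [b [bx bU]] := nbhs_rat_ball (open_nbhs_nbhs (conj oU Ux)); exists b.
rewrite preimage_bigcup bigcup_mkcond.
apply: countable_bigcupT_measurable => [|b]; first exact: countableP.
case: ifPn => // _.
have -> : f @^-1` rat_ball b = \bigcap_(i in [set: 'I_d])
    ((fun t => f t 0 i) @^-1` ball (ratr (b.1 0 i) : R) b.2.+1%:R^-1).
  apply/seteqP; split=> [t [b0 ft] i _|t ft].
    by have := ft 0 i; rewrite mxE.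
  by split=> [|i j]; [rewrite /= invr_gt0|rewrite mxE ord1; exact: ft].
apply: fin_bigcap_measurable => // i _; rewrite -[X in measurable X]setTI.
by apply: mf => //; exact: measurable_ball.
Qed.

Lemma measurable_fun_coord {disp} {T : measurableType disp} (f : T -> V) i :
  measurable_fun setT f -> measurable_fun setT (fun t => f t 0 i).
Proof. by move=> mf; apply: (measurableT_comp (measurable_coord i)). Qed.

Lemma measurable_addrV {disp} {T : measurableType disp} (f g : T -> V) :
  measurable_fun setT f -> measurable_fun setT g ->
  measurable_fun setT (fun t => f t + g t).
Proof.
move=> mf mg; apply: measurable_fun_rV => i.
under eq_fun do rewrite mxE.
by apply: measurable_funD; exact: measurable_fun_coord.
Qed.

Lemma measurable_scalerV {disp} {T : measurableType disp} (k : R) (f : T -> V) :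
  measurable_fun setT f -> measurable_fun setT (fun t => k *: f t).
Proof.
move=> mf; apply: measurable_fun_rV => i.
under eq_fun do rewrite mxE.
apply: (measurableT_comp (mulrl_measurable k)).
exact: measurable_fun_coord.
Qed.

Lemma measurable_subrV {disp} {T : measurableType disp} (f g : T -> V) :
  measurable_fun setT f -> measurable_fun setT g ->
  measurable_fun setT (fun t => f t - g t).
Proof.
move=> mf mg; under eq_fun do rewrite -scaleN1r.
by apply: measurable_addrV => //; exact: measurable_scalerV.
Qed.

Lemma measurable_inner {disp} {T : measurableType disp} (f g : T -> V) :
  measurable_fun setT f -> measurable_fun setT g ->
  measurable_fun setT (fun t => inner (f t) (g t)).
Proof.
move=> mf mg; rewrite /inner; apply: measurable_sum => i.
by apply: measurable_funM; exact: measurable_fun_coord.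
Qed.

End borel_measurability.

(** * Algebra and continuity of the Euclidean inner product *)

Section inner_algebra.
Context {R : realType} {d : nat}.
Implicit Types x y z : 'rV[R]_d.

Lemma innerC x y : inner x y = inner y x.
Proof. by apply: eq_bigr => i _; rewrite mulrC. Qed.

Lemma innerDl x y z : inner (x + y) z = inner x z + inner y z.
Proof. by rewrite /inner -big_split; apply: eq_bigr => i _; rewrite mxE mulrDl. Qed.

Lemma innerZl k x y : inner (k *: x) y = k * inner x y.
Proof. by rewrite /inner mulr_sumr; apply: eq_bigr => i _; rewrite mxE mulrA. Qed.

Lemma innerNl x y : inner (- x) y = - inner x y.
Proof. by rewrite -scaleN1r innerZl mulN1r. Qed.

Lemma innerBl x y z : inner (x - y) z = inner x z - inner y z.
Proof. by rewrite innerDl innerNl. Qed.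

Lemma innerDr x y z : inner z (x + y) = inner z x + inner z y.
Proof. by rewrite innerC innerDl !(innerC z). Qed.

Lemma innerZr k x y : inner x (k *: y) = k * inner x y.
Proof. by rewrite innerC innerZl innerC. Qed.

Lemma innerBr x y z : inner z (x - y) = inner z x - inner z y.
Proof. by rewrite innerC innerBl !(innerC z). Qed.

Lemma inner_ge0 x : 0 <= inner x x.
Proof. by apply: sumr_ge0 => i _; exact: sqr_ge0. Qed.

Lemma enorm_sqr x : enorm x ^+ 2 = inner x x.
Proof. by rewrite sqr_sqrtr// inner_ge0. Qed.

Lemma continuous_inner (T : topologicalType) (f g : T -> 'rV[R]_d) :
  continuous f -> continuous g -> continuous (fun t => inner (f t) (g t)).
Proof.
move=> cf cg t; apply: cvg_big => [|i _].
  exact: add_continuous.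
apply: cvgM.
  apply: (@continuous_comp _ _ _ f (fun y : 'rV[R]_d => y 0 i)).
    exact: cf.
  exact: coord_continuous.
apply: (@continuous_comp _ _ _ g (fun y : 'rV[R]_d => y 0 i)).
  exact: cg.
exact: coord_continuous.
Qed.

End inner_algebra.

(** * Bounded Lipschitz graphs are Lebesgue null *)

Section lipschitz_graph.
Context {R : realType}.

Lemma uniform_grid (n : nat) (delta t : R) : 0 <= t <= n.+1%:R * delta ->
  exists q : 'I_n.+1, q%:R * delta <= t <= q.+1%:R * delta.
Proof.
elim: n => [|n IHn] /andP[t0 tn]; first by exists ord0; rewrite mul0r t0 tn.
have [tn1|/ltW tn1] := leP t (n.+1%:R * delta).
  have [|q qP] := IHn; first by rewrite t0 tn1.
  by exists (widen_ord (leqnSn _) q).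
by exists ord_max; rewrite tn1 tn.
Qed.

Lemma finite_pred_series (N : nat) (v : R) : 0 <= v ->
  (\sum_(0 <= k <oo | (k < N)%N) v%:E = (N%:R * v)%:E)%E.
Proof.
move=> v0.
rewrite (nneseries_split_cond 0 N)//.
rewrite add0n [X in (_ + X)%E]eseries0 ?adde0; last first.
  by move=> k; rewrite ltnNge => ->.
rewrite big_mkord (eq_bigl xpredT) => [|k]; last exact: ltn_ord.
by rewrite sumEFin sumr_const card_ord mulr_natl.
Qed.

Lemma lebesgue_outer_ge0 d (E : set 'rV[R]_d) : (0 <= lebesgue_outer E)%E.
Proof.
apply/ereal_infP => _ [D [a [b [ab _ ->]]]].
apply: nneseries_ge0 => k _ _; rewrite lee_fin.
by apply: prodr_ge0 => i _; rewrite subr_ge0.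
Qed.

(** The finite cover is listed along [enum I] to be indexed by [nat]. An empty [I], for which [E] is
    empty, is split off because [nth] needs a default element. *)
Lemma lebesgue_outer_cover d (I : finType) (E : set 'rV[R]_d)
    (a b : I -> 'rV[R]_d) (v : R) :
  0 <= v -> (forall f i, a f 0 i <= b f 0 i) ->
  (forall f, \prod_(i < d) (b f 0 i - a f 0 i) = v) ->
  E `<=` [set x | exists f, cbox (a f) (b f) x] ->
  (lebesgue_outer E <= (#|I|%:R * v)%:E)%E.
Proof.
move=> v0 ab abv Eab; rewrite -finite_pred_series//.
case: (pickP (fun _ : I => true)) => [f0 _|I0]; last first.
  apply: ge_ereal_inf; eexists; last exact: lexx.
  exists (fun k => k < #|I|)%N, (fun=> 0), (fun=> 0).
  split=> //; first by move=> x /Eab[f]; have := I0 f.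
  by apply: eq_eseriesr => k; rewrite eq_card0.
pose e k := nth f0 (enum I) k.
apply: ge_ereal_inf; eexists; last exact: lexx.
exists (fun k => k < #|I|)%N, (a \o e), (b \o e).
split=> [k i|x /Eab[f fx]|]; first exact: ab.
  exists (enum_rank f); first exact: ltn_ord.
  by rewrite /e/= -[nth _ _ _](enum_val_nth f0) enum_rankK.
by apply: eq_eseriesr => k _; rewrite abv.
Qed.

(* Each of the [n ^ (d - 1)] grid cells in the coordinates other than [i]
   contains a piece of [E] of height [O(1/n)], which is cut into [n] slices so
   that the boxes are indexed by all the functions ['I_d -> 'I_n]. *)
Lemma lebesgue_outer_lipschitz_graph d (i : 'I_d) (E : set 'rV[R]_d) (C K : R) :
  0 <= C -> 0 <= K -> (forall x, E x -> forall j, `|x 0 j| <= K) ->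
  (forall x y, E x -> E y ->
    `|x 0 i - y 0 i| <= C * \sum_(j < d | j != i) `|x 0 j - y 0 j|) ->
  lebesgue_outer E = 0%E.
Proof.
move=> C0 K0 EK EC; apply/eqP; rewrite eq_le lebesgue_outer_ge0 andbT.
(* [B / n.+1] is the total volume of [n.+1 ^ d] boxes of volume [(2 K / n.+1) ^ d * (2 C d / n.+1)]
   each. *)
pose B := (2 * K) ^+ d * (2 * C * d%:R).
have B0 : 0 <= B by rewrite !mulr_ge0// exprn_ge0// mulr_ge0.
suff bnd n : (lebesgue_outer E <= (B / n.+1%:R)%:E)%E.
  apply/lee_addgt0Pr => e e0; rewrite add0e.
  pose n := Num.truncn (B / e).
  apply: (le_trans (bnd n)); rewrite lee_fin ler_pdivrMr// mulrC -ler_pdivrMr//.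
  by rewrite ltW// truncnS_gt.
have n0 : n.+1%:R != 0 :> R by rewrite pnatr_eq0.
pose delta : R := 2 * K / n.+1%:R.
have delta0 : 0 <= delta by rewrite divr_ge0// mulr_ge0.
(* Over one cell the other coordinates vary by at most [delta] each, so coordinate [i] varies by at
   most [rho]. *)
pose rho := C * (d%:R * delta).
have rho0 : 0 <= rho by rewrite !mulr_ge0.
pose cell (f : {ffun 'I_d -> 'I_n.+1}) : set 'rV[R]_d := [set x | E x /\
  forall j, j != i -> (f j)%:R * delta <= x 0 j + K <= (f j).+1%:R * delta].
pose rep f := xget (0 : 'rV[R]_d) (cell f).
pose w j := delta * (if j == i then 2 * C * d%:R / n.+1%:R else 1).
have w0 j : 0 <= w j.
  by rewrite mulr_ge0//; case: ifP => // _; rewrite divr_ge0// !mulr_ge0.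
(* The value [f i] numbers a slice of the column over a cell; resetting it to [ord0] makes the
   representative depend on the cell alone. *)
pose a (f : {ffun 'I_d -> 'I_n.+1}) := \row_j (if j == i then
    rep [ffun k => if k == i then ord0 else f k] 0 i - rho
  else - K) + \row_j ((f j)%:R * w j).
pose b (f : {ffun 'I_d -> 'I_n.+1}) := a f + \row_j w j.
pose v := delta ^+ d * (2 * C * d%:R / n.+1%:R).
have <- : (#|{ffun 'I_d -> 'I_n.+1}|%:R * v = B / n.+1%:R).
  rewrite card_ffun !card_ord natrX /v /B /delta expr_div_n.
  by rewrite mulrA (mulrC (_ ^+ d) (_ / _)) divfK ?expf_neq0// !mulrA.
apply: (@lebesgue_outer_cover _ _ _ a b) => [|f j|f|x Ex].
- by rewrite mulr_ge0 ?exprn_ge0// divr_ge0// !mulr_ge0.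
- by rewrite [leRHS]mxE lerDl mxE.
- rewrite (eq_bigr w) => [|j _]; last by rewrite [b f 0 j]mxE addrAC subrr add0r mxE.
  rewrite big_split/= prodr_const card_ord; congr (_ * _).
  by rewrite (bigD1 i)//= eqxx big1 ?mulr1// => j /negbTE ->.
have Kn : n.+1%:R * delta = 2 * K by rewrite mulrC divfK.
have /choice[q qP] (j : 'I_d) : exists q : 'I_n.+1,
    q%:R * delta <= x 0 j + K <= q.+1%:R * delta.
  apply: uniform_grid; rewrite Kn.
  by have := EK _ Ex j; rewrite ler_norml => /andP[? ?]; apply/andP; split; lra.
pose g : {ffun 'I_d -> 'I_n.+1} := [ffun k => if k == i then ord0 else q k].
have gx : cell g x by split=> // j ji; rewrite ffunE (negbTE ji).
have [Ec cg] : cell (g : {ffun _}) (rep g) := xgetI 0 gx.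
set y := rep g in Ec cg.
have xy : `|x 0 i - y 0 i| <= rho.
  apply: (le_trans (EC _ _ Ex Ec)); apply: ler_wpM2l => //.
  have -> : d%:R * delta = \sum_(j < d) delta.
    by rewrite sumr_const card_ord mulr_natl.
  rewrite [leRHS](bigID (fun j => j != i))/=.
  apply: ler_wpDr; first exact: sumr_ge0.
  apply: ler_sum => j ji; have := gx.2 _ ji; have := cg _ ji.
  rewrite -!natr1 !mulrDl mul1r.
  move: (_%:R * delta) => p /andP[? ?] /andP[? ?].
  by rewrite ler_norml; apply/andP; split; lra.
have [r rP] : exists r : 'I_n.+1,
    r%:R * w i <= x 0 i - y 0 i + rho <= r.+1%:R * w i.
  apply: uniform_grid.
  have -> : n.+1%:R * w i = 2 * rho by rewrite /w eqxx /rho; field.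
  by move: xy; rewrite ler_norml => /andP[? ?]; apply/andP; split; lra.
exists [ffun k => if k == i then r else q k] => j.
rewrite /b /a.
rewrite (_ : [ffun k => if k == i then ord0 else _] = g); last first.
  by apply/ffunP => k; rewrite !ffunE; case: (k == i).
rewrite -/y !mxE ffunE -addrA; case: ifPn => [/eqP ->|ji].
  by move: rP; rewrite -natr1 mulrDl mul1r => /andP[? ?]; apply/andP; split; lra.
move: (qP j); rewrite /w (negbTE ji) mulr1 -natr1 mulrDl mul1r.
by move=> /andP[? ?]; apply/andP; split; lra.
Qed.

End lipschitz_graph.

(** * Image measures, midpoints and product measures *)

Section probability_constructions.
Context {R : realType}.

Lemma pushforward_probability {d1 d2} {T1 : measurableType d1}
    {T2 : measurableType d2} (m : probability T1 R) (f : T1 -> T2) :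
  measurable_fun setT f -> exists P : probability T2 R, is_pushforward m f P.
Proof.
move=> mf; pose X : {mfun T1 >-> T2} := mfun_Sub (mem_set mf).
by exists (distribution m X).
Qed.

Lemma ge0_integral_is_pushforward {d1 d2} {T1 : measurableType d1}
    {T2 : measurableType d2} (m : {measure set T1 -> \bar R}) (f : T1 -> T2)
    (m' : {measure set T2 -> \bar R}) (h : T2 -> \bar R) :
  measurable_fun setT f -> is_pushforward m f m' ->
  measurable_fun setT h -> (forall y, 0 <= h y)%E ->
  (\int[m']_y h y = \int[m]_x h (f x))%E.
Proof.
move=> mf mm' mh h0; pose X : {mfun T1 >-> T2} := mfun_Sub (mem_set mf).
rewrite (@eq_measure_integral _ _ _ _ (pushforward m X)) => [|A mA _].
  by rewrite ge0_integral_pushforward// => y _.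
exact: mm'.
Qed.

Lemma midpoint_probability {d} {T : measurableType d} (m1 m2 : probability T R) :
  exists P : probability T R,
    (forall A, P A = 2^-1%:E * (m1 A + m2 A))%E /\
    forall h, measurable_fun setT h -> (forall x, 0 <= h x)%E ->
      (\int[P]_x h x = 2^-1%:E * (\int[m1]_x h x + \int[m2]_x h x))%E.
Proof.
have r0 : 0 <= 2^-1 :> R by rewrite invr_ge0.
pose m := mscale (NngNum r0) (measure_add m1 m2).
have mT : m setT = 1%E.
  transitivity (2^-1%:E * (m1 setT + m2 setT))%E; first by rewrite -measure_addE.
  by rewrite !probability_setT -EFinD -EFinM mulVf.
pose P : probability T R := HB.pack m (Measure_isProbability.Build _ _ _ m mT).
exists P; split=> [A|h mh h0].
  by rewrite -measure_addE.
by rewrite ge0_integral_mscale//= ge0_integral_measure_add.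
Qed.

(** The image under the swap agrees with the product on rectangles, which determine the product
    measure. *)
Lemma product_measure_swap {d} {T : measurableType d} (m : probability T R)
    (X : set (T * T)) : measurable X ->
  ((m \x m) ((fun z => (z.2, z.1)) @^-1` X) = (m \x m) X)%E.
Proof.
move=> mX; have ms : measurable_fun setT (fun z : T * T => (z.2, z.1)).
  by apply: measurable_fun_pair.
have [P PE] := pushforward_probability (m \x m)%E ms.
rewrite -[LHS]PE//; apply/esym/product_measure_unique => // A B mA mB.
apply: etrans; first by apply: PE; exact: measurableX.
rewrite /pushforward (_ : _ @^-1` _ = B `*` A); last first.
  by apply/seteqP; split=> -[x y] [].
by rewrite muleC; exact: product_measure1E.
Qed.

Lemma product_measure_fst {d} {T : measurableType d} (m : probability T R) :
  is_pushforward (m \x m)%E fst m.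
Proof.
move=> A mA; rewrite /pushforward (_ : _ @^-1` _ = A `*` setT).
  apply: etrans; last by apply/esym/product_measure1E.
  by rewrite [X in (_ * X)%E]probability_setT mule1.
by apply/seteqP; split=> [[x y] /= ?|[x y] []].
Qed.

Lemma product_measure_snd {d} {T : measurableType d} (m : probability T R) :
  is_pushforward (m \x m)%E snd m.
Proof.
move=> A mA; rewrite /pushforward (_ : _ @^-1` _ = setT `*` A).
  apply: etrans; last by apply/esym/product_measure1E.
  by rewrite [X in (X * _)%E]probability_setT mul1e.
by apply/seteqP; split=> [[x y] /= ?|[x y] []].
Qed.

End probability_constructions.

(** * The squared transport cost *)

Section transport.
Context {R : realType} {d : nat}.
Local Notation V := 'rV[R]_d.
Local Open Scope ereal_scope.
Implicit Types (mu nu : P2 R d) (g : probability (V * V)%type R).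

Definition sqdist (z : V * V) : R := inner (z.1 - z.2) (z.1 - z.2).

Lemma sqdist_ge0 z : 0 <= (sqdist z)%:E.
Proof. by rewrite lee_fin inner_ge0. Qed.

Lemma measurable_sqdist : measurable_fun setT (EFin \o sqdist).
Proof.
by apply/measurable_EFinP; apply: measurable_inner; apply: measurable_subrV.
Qed.

Lemma transport_cost_sqr g : transport_cost g ^+ 2 = \int[g]_z (sqdist z)%:E.
Proof.
have cost_ge0 : 0 <= \int[g]_z (enorm (z.1 - z.2) ^+ 2)%:E.
  by apply: integral_ge0 => z _; rewrite lee_fin sqr_ge0.
rewrite /transport_cost poweR12_sqrt// sqr_sqrte//.
by apply: eq_integral => z _; rewrite enorm_sqr.
Qed.

Lemma transport_cost_ge0 g : 0 <= transport_cost g.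
Proof. exact: poweR_ge0. Qed.

Lemma W2_ge0 mu nu : 0 <= W2 mu nu.
Proof. by apply/ereal_infP => _ [g _ <-]; exact: transport_cost_ge0. Qed.

Lemma W2_sqr_le mu nu g : coupling mu nu g ->
  W2 mu nu ^+ 2 <= \int[g]_z (sqdist z)%:E.
Proof.
move=> cg; rewrite -transport_cost_sqr lee_sqr ?W2_ge0 ?transport_cost_ge0//.
by apply: ge_ereal_inf; exists (transport_cost g) => //; exists g.
Qed.

Lemma W2_sqr_optimal mu nu g : optimal_coupling mu nu g ->
  W2 mu nu ^+ 2 = \int[g]_z (sqdist z)%:E.
Proof. by move=> [_ <-]; rewrite transport_cost_sqr. Qed.

Lemma P2_second_moment mu : \int[mu]_x (inner x x)%:E < +oo.
Proof.
rewrite (eq_integral (fun x => (enorm x ^+ 2)%:E)); first exact: P2_moment.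
by move=> x _; rewrite enorm_sqr.
Qed.

(** [|x - y|^2 <= 2 |x|^2 + 2 |y|^2], and the squared norms on the right integrate to the second
    moments of the marginals. *)
Lemma coupling_cost_lty mu nu g : coupling mu nu g ->
  \int[g]_z (sqdist z)%:E < +oo.
Proof.
move=> [gmu gnu].
have m1 : measurable_fun setT (fun z : V * V => (inner z.1 z.1)%:E).
  by apply/measurable_EFinP; exact: measurable_inner.
have m2 : measurable_fun setT (fun z : V * V => (inner z.2 z.2)%:E).
  by apply/measurable_EFinP; exact: measurable_inner.
have mI : measurable_fun setT (fun x : V => (inner x x)%:E).
  by apply/measurable_EFinP; exact: measurable_inner.
have i0 (x : V) : 0 <= (inner x x)%:E by rewrite lee_fin inner_ge0.
apply: (@le_lt_trans _ _ (\int[g]_z (2%:E * ((inner z.1 z.1)%:E + (inner z.2 z.2)%:E)))).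
  apply: ge0_le_integral => //.
  - by move=> z _; exact: sqdist_ge0.
  - exact: measurable_sqdist.
  - by apply: measurable_funeM; exact: emeasurable_funD.
  move=> z _; rewrite -EFinD -EFinM lee_fin.
  have := inner_ge0 (z.1 + z.2).
  rewrite /sqdist innerBl !innerBr innerDl !innerDr (innerC z.2 z.1).
  by move: (inner _ _) (inner _ _) (inner _ _) => a b c; lra.
rewrite ge0_integralZl//; last 2 first.
- exact: emeasurable_funD.
- by move=> z _; rewrite adde_ge0.
rewrite ge0_integralD//.
rewrite -(ge0_integral_is_pushforward measurable_fst gmu mI i0).
rewrite -(ge0_integral_is_pushforward measurable_snd gnu mI i0).
by rewrite lte_mul_pinfty// lte_add_pinfty// P2_second_moment.
Qed.

End transport.

(** * Optimal couplings have monotone support *)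

Section monotone_support.
Context {R : realType} {d : nat}.
Local Notation V := 'rV[R]_d.
Local Open Scope ereal_scope.
Implicit Types (mu nu : P2 R d) (g : probability (V * V)%type R).

(** The inner product enters with a minus sign so as to appear as the saving made by exchanging the
    second endpoints. *)
Lemma inner_exchange (x y x' y' : V) :
  (inner (x - y') (x - y') + inner (x' - y) (x' - y) +
    2 * - inner (x - x') (y - y') =
  inner (x - y) (x - y) + inner (x' - y') (x' - y'))%R.
Proof.
rewrite !(innerBl, innerBr) !(innerC y x) !(innerC y x') !(innerC y' x).
by rewrite !(innerC y' x'); lra.
Qed.

(** Pairs of trajectories that become strictly cheaper when their endpoints are exchanged. *)
Definition crossing : set ((V * V) * (V * V)) :=
  [set z | (inner (z.1.1 - z.2.1) (z.1.2 - z.2.2) < 0)%R].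

Lemma measurable_crossing_inner : measurable_fun setT
  (fun z : (V * V) * (V * V) => inner (z.1.1 - z.2.1) (z.1.2 - z.2.2)).
Proof.
by apply: measurable_inner; apply: measurable_subrV; apply: measurableT_comp.
Qed.

Lemma measurable_crossing : measurable crossing.
Proof.
have mb : measurable_fun setT (fun z : (V * V) * (V * V) =>
    inner (z.1.1 - z.2.1) (z.1.2 - z.2.2) < 0)%R.
  by apply: measurable_fun_ltr => //; exact: measurable_crossing_inner.
by rewrite -[X in measurable X]setTI; exact: (mb measurableT [set true]).
Qed.

(* Exchanging the second endpoints of the crossing pairs of two independent
   copies of [g] yields a new coupling of the same marginals, strictly cheaper
   unless almost no pair is crossing. *)
Lemma optimal_coupling_crossing mu nu g : optimal_coupling mu nu g ->
  (g \x g) crossing = 0.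
Proof.
move=> og; have [gmu gnu] := og.1.
pose phi (z : (V * V) * (V * V)) := inner (z.1.1 - z.2.1) (z.1.2 - z.2.2).
have mphi : measurable_fun setT phi := measurable_crossing_inner.
pose b z := (phi z < 0)%R.
have mb : measurable_fun setT b by apply: measurable_fun_ltr.
pose sw (z : (V * V) * (V * V)) := (z.2, z.1).
have msw : measurable_fun setT sw by exact: measurable_fun_pair.
have bsw z : b (sw z) = b z.
  by rewrite /b /phi /= -opprB innerNl -(opprB z.1.2) innerC innerNl opprK innerC.
pose F z := (z.1.1, if b z then z.2.2 else z.1.2).
have mF : measurable_fun setT F.
  apply: measurable_fun_pair; first exact: measurableT_comp.
  by apply: measurable_fun_ifT => //; exact: measurableT_comp.
pose gg := (g \x g)%E.
have mA : measurable (b @^-1` [set true]) by exact: measurable_crossing.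
have [h hE] := pushforward_probability gg mF.
have hc : coupling mu nu h.
  split=> B mB.
    rewrite gmu// /pushforward hE; last first.
      by rewrite -[X in measurable X]setTI; exact: measurable_fst.
    have mB1 : measurable (fst @^-1` B : set (V * V)).
      by rewrite -[X in measurable X]setTI; exact: measurable_fst.
    exact: (product_measure_fst g mB1).
  have mB2 : measurable (snd @^-1` B : set (V * V)).
    by rewrite -[X in measurable X]setTI; exact: measurable_snd.
  have mB3 : measurable (fst @^-1` (snd @^-1` B) : set ((V * V) * (V * V))).
    by rewrite -[X in measurable X]setTI; exact: measurable_fst.
  have mB4 : measurable (snd @^-1` (snd @^-1` B) : set ((V * V) * (V * V))).
    by rewrite -[X in measurable X]setTI; exact: measurable_snd.
  (* On the crossing set the new endpoint is that of the swapped pair. Both this set and [g \x g]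
     are invariant under the swap, so this part has the mass of [Y]; [Z] is the part left
     unchanged. *)
  pose A := b @^-1` [set true]; pose Z := fst @^-1` (snd @^-1` B) `\` A.
  pose Y := A `&` fst @^-1` (snd @^-1` B).
  have mY : measurable Y by exact: measurableI.
  have mZ : measurable Z by exact: measurableD.
  have swY : gg (sw @^-1` Y) = gg Y by exact: product_measure_swap.
  have e1 : gg (fst @^-1` (snd @^-1` B)) = gg Y + gg Z.
    rewrite -[RHS]measureU//; first by rewrite /Y setIC setUIDK.
    by apply/seteqP; split=> // z [[bz _] []].
  have e2 : gg (F @^-1` (snd @^-1` B)) = gg (sw @^-1` Y) + gg Z.
    rewrite -[RHS]measureU//.
    - congr (gg _); apply/seteqP; split=> [z|z]; rewrite /F /Y /Z /A /=
        -/(sw z) bsw; case: (b z) => /=.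
      + by move=> Bz; left.
      + by move=> Bz; right.
      + by case=> -[].
      + by case=> -[].
    - by rewrite -[X in measurable X]setTI; exact: msw.
    - by apply/seteqP; split=> // z; rewrite /Y /A /= -/(sw z) bsw => -[[bz _] []].
  have e3 : gg (F @^-1` (snd @^-1` B)) = g (snd @^-1` B).
    by rewrite e2 swY -e1; apply/esym/(product_measure_fst g mB2).
  by rewrite gnu// /pushforward -e3; apply/esym/hE.
pose c z := (@sqdist R d z)%:E.
pose I := \int[g]_z c z.
have mc : measurable_fun setT c := measurable_sqdist.
have c0 z : 0 <= c z by exact: sqdist_ge0.
have Ioo : I < +oo by exact: coupling_cost_lty og.1.
have I0 : 0 <= I by exact: integral_ge0.
have mw : measurable_fun setT (c \o F) by exact: measurableT_comp.
have Iw : I <= \int[gg]_z c (F z).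
  rewrite -(ge0_integral_is_pushforward mF hE mc c0).
  by rewrite /I -(W2_sqr_optimal og); exact: W2_sqr_le.
have Iwsw : \int[gg]_z c (F (sw z)) = \int[gg]_z c (F z).
  apply/esym/(@ge0_integral_is_pushforward _ _ _ _ _ gg sw gg (c \o F)) => //.
  - by move=> X mX; apply/esym/product_measure_swap.
  - by move=> y; exact: c0.
(* [m] is the negative part of [phi]; [2 * m z] is what [F] saves on [z] and its swap together. *)
pose m z := (if b z then - phi z else 0)%R.
have m0 z : (0 <= m z)%R.
  by rewrite /m /b; case: ifP => // /ltW; rewrite oppr_ge0.
have mm : measurable_fun setT m.
  by apply: measurable_fun_ifT => //; exact: measurable_funN.
have ptwise z : c (F z) + c (F (sw z)) + (2 * m z)%:E = c z.1 + c z.2.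
  rewrite /c /sqdist /F /m bsw -!EFinD; congr EFin => /=.
  case: (b z) => /=; last by rewrite mulr0 addr0.
  by rewrite /phi inner_exchange.
have Isum : \int[gg]_z (c (F z) + c (F (sw z)) + (2 * m z)%:E) = I + I.
  under eq_integral do rewrite ptwise.
  rewrite ge0_integralD//; last 2 first.
  - exact: measurableT_comp.
  - exact: measurableT_comp.
  rewrite -(ge0_integral_is_pushforward measurable_fst (@product_measure_fst _ _ _ g) mc c0).
  by rewrite -(ge0_integral_is_pushforward measurable_snd (@product_measure_snd _ _ _ g) mc c0).
have m2m : measurable_fun setT (fun z => (2 * m z)%:E).
  by apply/measurable_EFinP; exact: (measurableT_comp (mulrl_measurable _)).
have m20 z : 0 <= (2 * m z)%:E by rewrite lee_fin mulr_ge0.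
have mwsw : measurable_fun setT (fun z => c (F (sw z))).
  exact: (measurableT_comp mw).
have mww : measurable_fun setT (fun z => c (F z) + c (F (sw z))).
  exact: emeasurable_funD.
have int3 : \int[gg]_z (c (F z) + c (F (sw z)) + (2 * m z)%:E) =
    \int[gg]_z c (F z) + \int[gg]_z c (F (sw z)) + \int[gg]_z (2 * m z)%:E.
  apply: etrans; first by apply: ge0_integralD => // z _; rewrite adde_ge0.
  by congr (_ + _); exact: ge0_integralD.
move: Isum; rewrite int3 Iwsw => Isum.
(* Each exchanged integral is at least the optimal cost [I], while all three terms add up to
   [I + I], which is finite. *)
have int0 : \int[gg]_z (2 * m z)%:E = 0.
  apply/eqP; rewrite eq_le integral_ge0// andbT.
  have Ifin : I + I \is a fin_num by rewrite fin_numD ge0_fin_numE// Ioo.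
  by rewrite -(leeD2lE _ _ Ifin) adde0 -[leRHS]Isum leeD2r// leeD.
have /ae_eq_integral_abs : \int[gg]_z `|(2 * m z)%:E| = 0.
  by under eq_integral do rewrite gee0_abs//.
move=> /(_ measurableT m2m) [N [mN N0 sN]].
apply: (subset_measure0 _ mN _ N0); first exact: mA.
move=> z bz; apply: sN => /= /(_ Logic.I) [].
apply/eqP; rewrite mulf_neq0 ?pnatr_eq0// /m (bz : b z) oppr_eq0.
by rewrite (lt_eqF (bz : phi z < 0)%R).
Qed.

(** [S] is the support of [g]: the null boxes of a countable base are removed. Around two crossing
    points of [S], the open set [crossing] would contain a product of two boxes of positive measure,
    although it is null. *)
Lemma optimal_coupling_monotone mu nu g : optimal_coupling mu nu g ->
  exists S : set (V * V), [/\ measurable S, closed S, g (~` S) = 0 &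
    forall z z', S z -> S z' -> (0 <= inner (z.1 - z'.1) (z.2 - z'.2))%R].
Proof.
move=> /optimal_coupling_crossing gg0.
pose B (b : ('rV[rat]_d * nat) * ('rV[rat]_d * nat)) : set (V * V) :=
  rat_ball b.1 `*` rat_ball b.2.
have mB b : measurable (B b) by apply: measurableX; exact: measurable_rat_ball.
have nbhsB (z : V * V) (A : set (V * V)) : nbhs z A ->
    exists b, B b z /\ B b `<=` A.
  move=> [[A1 A2] [/= zA1 zA2] sA].
  have [b1 [b1z b1A]] := nbhs_rat_ball zA1.
  have [b2 [b2z b2A]] := nbhs_rat_ball zA2.
  exists (b1, b2); split=> // y [/= /b1A yA1 /b2A yA2]; exact: sA.
(* Codes of no box and boxes of positive measure contribute [set0], so that every [G n] is null. *)
pose G n := if unpickle n is Some b then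
  (if g (B b) == 0 then B b else set0) else set0.
have mG n : measurable (G n).
  by rewrite /G; case: unpickle => // b; case: ifP.
have gG n : g (G n) = 0.
  rewrite /G; case: unpickle => [b|]; last by rewrite measure0.
  by case: ifPn => [/eqP //|_]; rewrite measure0.
exists (~` \bigcup_n G n); split.
- exact/measurableC/bigcupT_measurable.
- apply: open_closedC; apply: bigcup_open => n _; rewrite /G.
  case: unpickle => [b|]; last exact: open0.
  case: ifP => _; last exact: open0.
  rewrite (_ : B b = fst @^-1` rat_ball b.1 `&` snd @^-1` rat_ball b.2)//.
  apply: openI; apply: open_comp; try exact: ball_open.
    by move=> z _; exact: cvg_fst.
  by move=> z _; exact: cvg_snd.
- rewrite setCK; apply/eqP; rewrite -measure_le0.
  have mUG : measurable (\bigcup_n G n) by exact: bigcupT_measurable.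
  apply: (le_trans (measure_sigma_subadditive g mG mUG _)) => //.
  by rewrite eseries0// => n _ _; exact: gG.
move=> z z' Sz Sz'; rewrite leNgt; apply/negP => zz'.
have cont : continuous (fun w : (V * V) * (V * V) =>
    inner (w.1.1 - w.2.1) (w.1.2 - w.2.2)).
  apply: continuous_inner => w; apply: cvgB.
  - by apply: (@continuous_comp _ _ _ fst fst); exact: cvg_fst.
  - by apply: (@continuous_comp _ _ _ snd fst); [exact: cvg_snd|exact: cvg_fst].
  - by apply: (@continuous_comp _ _ _ fst snd); [exact: cvg_fst|exact: cvg_snd].
  - by apply: (@continuous_comp _ _ _ snd snd); exact: cvg_snd.
have [[A A'] [/= zA zA'] sA] : nbhs (z, z') crossing.
  apply: open_nbhs_nbhs; split=> //.
  apply: (@open_comp _ _ _ [set x : R | (x < 0)%R] (fun w _ => cont w)).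
  exact: open_lt.
have [b [bz bA]] := nbhsB _ _ zA.
have [b' [bz' bA']] := nbhsB _ _ zA'.
have pos b0 y : B b0 y -> (~` \bigcup_n G n) y -> g (B b0) != 0.
  move=> by0 Sy; apply: contra_notN Sy => gB0.
  exists (pickle b0); first exact: Logic.I.
  by rewrite /G pickleK gB0.
have : (g \x g) (B b `*` B b') = 0.
  apply: (subset_measure0 _ measurable_crossing _ gg0); first exact: measurableX.
  by move=> y [/= /bA ? /bA' ?]; exact: sA.
rewrite product_measure1E//; apply/eqP.
by apply: mule_neq0; [exact: (pos _ z)|exact: (pos _ z')].
Qed.

End monotone_support.

(** * A closed monotone set is a graph off a Lebesgue null set *)

Section monotone_graph.
Context {R : realType} {d : nat}.
Local Notation V := 'rV[R]_d.

Lemma normr_coord (x : V) i : `|x 0 i| <= `|x|.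
Proof.
by rewrite [leRHS]/Num.norm/= mx_normrE; apply: (le_bigmax _ _ (0, i)).
Qed.

Lemma compact_norm_le (M : R) : compact [set x : V | `|x| <= M].
Proof.
apply: bounded_closed_compact.
  by exists M; split; [exact: num_real|move=> y My x /= /le_trans; apply; exact: ltW].
apply: (@closed_comp _ _ (fun x : V => `|x|) [set r | r <= M]); last exact: closed_le.
by move=> x _; exact: norm_continuous.
Qed.

Context (S : set (V * V)) (S_closed : closed S)
  (S_monotone :
    forall z z', S z -> S z' -> 0 <= inner (z.1 - z'.1) (z.2 - z'.2)).

(** The bound [M] makes this, for closed [C], the projection of a compact set; the unbounded
    projection is recovered as a countable union over [M]. *)
Definition fiber_proj (M : nat) (C : set V) : set V :=
  [set x | `|x| <= M%:R /\ exists y, [/\ `|y| <= M%:R, C y & S (x, y)]].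

Lemma measurable_fiber_proj M (C : set V) : closed C ->
  measurable (fiber_proj M C).
Proof.
move=> cC; apply: compact_measurable_rV.
pose ballM : set V := [set x | `|x| <= M%:R].
pose K := (ballM `*` ballM) `&` (S `&` snd @^-1` C).
have -> : fiber_proj M C = fst @` K.
  apply/seteqP; split=> [x [xM [y [yM Cy Sxy]]]|_ [[x y] [[/= xM yM] [Sxy Cy]] <-]].
    by exists (x, y).
  by split=> //; exists y.
apply: continuous_compact.
  by apply: continuous_subspaceT => z; exact: cvg_fst.
apply: compact_closedI; first by apply: compact_setX; exact: compact_norm_le.
apply: closedI => //; apply: closed_comp => // z _; exact: cvg_snd.
Qed.

(** Rational thresholds and an integer bound leave countably many such sets; on each, [M] and the
    gap [q - p] give a uniform Lipschitz constant. *)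
Definition multivalued (w : 'I_d * rat * rat * nat) : set V :=
  let: (i, p, q, M) := w in
  fiber_proj M [set y | y 0 i <= ratr p] `&`
  fiber_proj M [set y | ratr q <= y 0 i].

Lemma measurable_multivalued w : measurable (multivalued w).
Proof.
move: w => [[[i p] q] M]; apply: measurableI; apply: measurable_fiber_proj.
  apply: (@closed_comp _ _ (fun y : V => y 0 i) [set r | r <= ratr p]).
    by move=> x _; exact: coord_continuous.
  exact: closed_le.
apply: (@closed_comp _ _ (fun y : V => y 0 i) [set r | ratr q <= r]).
  by move=> x _; exact: coord_continuous.
exact: closed_ge.
Qed.

(* Two values whose [i]-th coordinates are separated by the gap [q - p] force
   the points of the domain onto a Lipschitz graph over the other coordinates. *)
Lemma monotone_coord_le (i : 'I_d) (p q M : R) (x x' y y' : V) :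
  p < q -> `|y| <= M -> `|y'| <= M -> y 0 i <= p -> q <= y' 0 i ->
  S (x, y) -> S (x', y') ->
  x 0 i - x' 0 i <= 2 * M / (q - p) * \sum_(j < d | j != i) `|x 0 j - x' 0 j|.
Proof.
move=> pq yM yM' yp yq Sxy Sxy'.
have M0 : 0 <= M := le_trans (normr_ge0 _) yM.
have qp0 : 0 < q - p by rewrite subr_gt0.
have sum0 : 0 <= \sum_(j < d | j != i) `|x 0 j - x' 0 j| by exact: sumr_ge0.
have [xx|/ltW xx] := leP (x 0 i - x' 0 i) 0.
  by apply: (le_trans xx); rewrite mulr_ge0// divr_ge0// ?mulr_ge0// ltW.
rewrite mulrAC ler_pdivlMr//.
(* The [i]-th summand is nonpositive here, so the remaining ones must compensate it; in these the
   entries of [y - y'] are at most [2 * M] in absolute value. *)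
have := S_monotone Sxy Sxy'; rewrite /inner (bigD1 i)//= !mxE => mon.
have le1 : (x 0 i - x' 0 i) * (q - p) <= (x 0 i - x' 0 i) * (y' 0 i - y 0 i).
  by apply: ler_wpM2l => //; lra.
have le2 : (x 0 i - x' 0 i) * (y' 0 i - y 0 i) <=
    \sum_(j < d | j != i) (x - x') 0 j * (y - y') 0 j.
  by rewrite -subr_ge0; apply: (le_trans mon); rewrite le_eqVlt; apply/orP; left;
    apply/eqP; ring.
apply: (le_trans le1); apply: (le_trans le2); rewrite mulr_sumr.
apply: ler_sum => j _; apply: (le_trans (ler_norm _)).
rewrite normrM mulrC !mxE ler_wpM2r//.
apply: (le_trans (ler_normB _ _)); rewrite mulr_natl mulr2n.
by apply: lerD; apply: (le_trans (normr_coord _ _)).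
Qed.

(** Stated for every subset [B] because absolute continuity tests null sets on their measurable
    subsets. *)
Lemma lebesgue_outer_multivalued i (p q : rat) M (B : set V) : p < q ->
  B `<=` multivalued (i, p, q, M) -> lebesgue_outer B = 0%E.
Proof.
move=> pq BE; have pqR : ratr p < ratr q :> R by rewrite ltr_rat.
pose C : R := 2 * M%:R / (ratr q - ratr p).
have C0 : 0 <= C by rewrite divr_ge0 ?mulr_ge0// subr_ge0 ltW.
apply: (@lebesgue_outer_lipschitz_graph _ _ i B C M%:R) => //.
  by move=> x /BE[[xM _] _] j; exact: le_trans (normr_coord _ _) xM.
(* Every point of [B] carries both a low and a high value, so the one-sided estimate also holds with
   the two points exchanged. *)
have half x x' : B x -> B x' ->
    x 0 i - x' 0 i <= C * \sum_(j < d | j != i) `|x 0 j - x' 0 j|.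
  move=> /BE[[_ [y [yM yp Sy]]] _] /BE[_ [_ [y' [yM' yq Sy']]]].
  exact: (monotone_coord_le pqR yM yM' yp yq Sy Sy').
move=> x x' Bx Bx'; rewrite ler_norml half// andbT lerNl opprB.
under eq_bigr do rewrite distrC.
exact: half.
Qed.

Definition multivalued_all : set V :=
  \bigcup_(w in [set w : 'I_d * rat * rat * nat | w.1.1.2 < w.1.2]) multivalued w.

Lemma measurable_multivalued_all : measurable multivalued_all.
Proof.
rewrite /multivalued_all bigcup_mkcond.
apply: countable_bigcupT_measurable => [|w]; first exact: countableP.
by case: ifP => // _; exact: measurable_multivalued.
Qed.

Lemma multivalued_all_null (m : {measure set V -> \bar R}) :
  m `<< lebesgue_outer -> m multivalued_all = 0%E.
Proof.
move=> ac; pose G n := if (unpickle n : option ('I_d * rat * rat * nat)%type) is Some w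
  then (if w.1.1.2 < w.1.2 then multivalued w else set0) else set0.
have mG n : measurable (G n).
  rewrite /G; case: unpickle => // w; case: ifP => // _.
  exact: measurable_multivalued.
have G0 n : m (G n) = 0%E.
  rewrite /G; case: unpickle => [w|]; last exact: measure0.
  case: ifP => pq; last exact: measure0.
  apply: ac; last 2 first.
  - exact: measurable_multivalued.
  - exact: subset_refl.
  move=> B mB Bw; move: w pq Bw => [[[i p] q] M] /= pq.
  exact: lebesgue_outer_multivalued.
apply/eqP; rewrite -measure_le0.
apply: (le_trans (measure_sigma_subadditive m mG measurable_multivalued_all _)).
  move=> x [w /= pq wx]; exists (pickle w); first exact: Logic.I.
  by rewrite /G pickleK pq.
by rewrite eseries0.
Qed.

(** Two values differing in a coordinate leave room for rationals [p < q] between them, and a large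
    [M] then puts [x] in a [multivalued] set. *)
Lemma single_valued x y y' : ~ multivalued_all x -> S (x, y) -> S (x, y') ->
  y = y'.
Proof.
move=> xN Sy Sy'; apply/rowP => i.
have half u v : S (x, u) -> S (x, v) -> u 0 i <= v 0 i.
  move=> Su Sv; rewrite leNgt; apply/negP => vu; apply: xN.
  have [p] := rat_in_itvoo vu; rewrite in_itv/= => /andP[vp pu].
  have [q] := rat_in_itvoo pu; rewrite in_itv/= => /andP[pq qu].
  pose M := (Num.truncn (Num.max `|x| (Num.max `|u| `|v|))).+1.
  have := truncnS_gt (Num.max `|x| (Num.max `|u| `|v|)).
  rewrite -/M !gt_max => /and3P[/ltW xM /ltW uM /ltW vM].
  exists (i, p, q, M); first by move: pq; rewrite ltr_rat.
  split; split=> //; [exists v|exists u]; split=> //=; exact: ltW.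
by apply/eqP; rewrite eq_le !half.
Qed.

(** The value 0 is a convention on multivalued points and, through [xget], over empty fibers. *)
Definition graph_map (x : V) : V :=
  if x \in multivalued_all then 0 else xget 0 [set y | S (x, y)].

Lemma graph_mapE x y : ~ multivalued_all x -> S (x, y) -> graph_map x = y.
Proof.
move=> xN Sxy; rewrite /graph_map memNset//.
exact: (single_valued xN (xgetI (0 : V) (Sxy : [set y | S (x, y)] y))).
Qed.

(** On [D], where the fiber is a single point, the preimage of a closed [C] is a countable union of
    the sets [fiber_proj M C]; off [D] the map is constantly 0. *)
Lemma measurable_graph_map : measurable_fun setT graph_map.
Proof.
pose D := \bigcup_M fiber_proj M setT `\` multivalued_all.
have mD : measurable D.
  apply: measurableD; last exact: measurable_multivalued_all.
  by apply: bigcupT_measurable => M; exact: measurable_fiber_proj closedT.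
have fiberP x y : S (x, y) -> forall C : set V, C y ->
    (\bigcup_M fiber_proj M C) x.
  move=> Sxy C Cy; pose M := (Num.truncn (Num.max `|x| `|y|)).+1.
  have := truncnS_gt (Num.max `|x| `|y|).
  rewrite -/M gt_max => /andP[/ltW xM /ltW yM].
  by exists M => //; split=> //; exists y.
have DT x C : D x -> (C (graph_map x) <-> (\bigcup_M fiber_proj M C) x).
  move=> [[M _ [_ [y [_ _ Sxy]]]] xN]; rewrite (graph_mapE xN Sxy); split.
    exact: fiberP.
  by move=> [M' _ [_ [y' [_ Cy' Sxy']]]]; rewrite (single_valued xN Sxy Sxy').
have DN x : ~ D x -> graph_map x = 0.
  move=> xD; rewrite /graph_map; case: ifPn => // /negP xN.
  case: xgetP => // y _ /= Sxy; exfalso; apply: xD; split; first exact: fiberP Sxy _ _.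
  by move=> ?; apply: xN; rewrite inE.
have closedM (C : set V) : closed C -> measurable (graph_map @^-1` C).
  move=> cC.
  have -> : graph_map @^-1` C = (D `&` \bigcup_M fiber_proj M C) `|`
      (if 0 \in C then ~` D else set0).
    apply/seteqP; split=> x /=.
      have [Dx Cx|/[dup] xD /DN -> C0] := pselect (D x).
        by left; split=> //; apply/(DT _ C Dx).
      by right; rewrite mem_set.
    case=> [[Dx Cx]|]; first by apply/(DT _ C Dx).
    by case: ifPn => // /set_mem C0 /DN ->.
  apply: measurableU; last by case: ifP => // _; exact: measurableC.
  apply: measurableI => //; apply: bigcupT_measurable => M.
  exact: measurable_fiber_proj.
apply: (measurability (@open V)) => // _ [U oU <-]; rewrite setTI.
have -> : graph_map @^-1` U = ~` (graph_map @^-1` (~` U)).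
  by apply/seteqP; split=> x /=; rewrite notK.
by apply: measurableC; apply: closedM; exact: open_closedC.
Qed.

End monotone_graph.

(** * Optimal couplings from absolutely continuous measures are carried by graphs *)

Section brenier.
Context {R : realType} {d : nat}.
Local Notation V := 'rV[R]_d.
Local Open Scope ereal_scope.
Implicit Types (mu nu : P2 R d) (g : probability (V * V)%type R).

Lemma le_measure_off_null {disp} {T : measurableType disp}
    (m : {measure set T -> \bar R}) (A B Z : set T) :
  measurable A -> measurable B -> measurable Z -> m Z = 0 ->
  A `\` Z `<=` B -> m A <= m B.
Proof.
move=> mA mB mZ Z0 AB; rewrite -[leRHS]adde0 -Z0.
apply: le_trans (measureU2 m mB mZ); apply: le_measure; rewrite ?inE//.
  exact: measurableU.
by move=> x Ax; have [Zx|Zx] := pselect (Z x); [right|left; exact: AB].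
Qed.

Lemma optimal_coupling_graph mu nu g :
  mu `<< lebesgue_outer -> optimal_coupling mu nu g ->
  exists2 T : V -> V, measurable_fun setT T &
    is_pushforward mu (fun x => (x, T x)) g.
Proof.
move=> ac og; have [gmu _] := og.1.
have [S [mS cS gS monS]] := optimal_coupling_monotone og.
exists (graph_map S); first exact: measurable_graph_map.
pose N := multivalued_all S.
have mN : measurable N by exact: measurable_multivalued_all.
have mN1 : measurable (fst @^-1` N : set (V * V)).
  by rewrite -[X in measurable X]setTI; exact: measurable_fst.
have muN : mu N = 0 by exact: multivalued_all_null.
have gN : g (fst @^-1` N) = 0 by rewrite -muN gmu.
(* Off the null set [Z] a pair lies in [S] over a single-valued point, so [A] and the cylinder over
   [B] coincide there; the cylinder has mass [mu B]. *)
pose Z := ~` S `|` fst @^-1` N.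
have mZ : measurable Z by apply: measurableU => //; exact: measurableC.
have gZ : g Z = 0.
  apply/eqP; rewrite -measure_le0 -(adde0 0) -{1}gS -gN.
  by apply: measureU2 => //; exact: measurableC.
have TZ z : ~ Z z -> graph_map S z.1 = z.2.
  move=> zZ; apply: graph_mapE => //.
    by move=> zN; apply: zZ; right.
  by case: z zZ => x y zZ /=; apply: contrapT => ?; apply: zZ; left.
move=> A mA; rewrite /pushforward.
have mT : measurable_fun setT (fun x => (x, graph_map S x)).
  by apply: measurable_fun_pair => //; exact: measurable_graph_map.
pose B := (fun x => (x, graph_map S x)) @^-1` A.
have mB : measurable B by rewrite -[X in measurable X]setTI; exact: mT.
have mB1 : measurable (fst @^-1` B : set (V * V)).
  by rewrite -[X in measurable X]setTI; exact: measurable_fst.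
rewrite gmu// /pushforward; apply/eqP; rewrite eq_le; apply/andP; split.
  apply: (le_measure_off_null mA mB1 mZ gZ) => z [Az zZ].
  by rewrite /= /B /= TZ// -surjective_pairing.
apply: (le_measure_off_null mB1 mA mZ gZ) => z [/= Bz zZ].
by move: Bz; rewrite /B /= TZ// -surjective_pairing.
Qed.

End brenier.

(** * Uniqueness of the optimal coupling *)

Section uniqueness.
Context {R : realType} {d : nat}.
Local Notation V := 'rV[R]_d.
Local Open Scope ereal_scope.
Implicit Types (mu nu : P2 R d) (g : probability (V * V)%type R).

Lemma sqre_inj (x y : \bar R) : 0 <= x -> 0 <= y -> x ^+ 2 = y ^+ 2 -> x = y.
Proof.
move=> x0 y0 xy; apply/eqP; rewrite eq_le.
by rewrite -lee_sqr// xy lexx/= -lee_sqr// xy lexx.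
Qed.

Lemma mule_half2 (x : \bar R) : 0 <= x -> 2^-1%:E * (x + x) = x.
Proof.
case: x => [x _|_|//]; last by rewrite addye// gt0_muley// lte_fin invr_gt0.
by rewrite -EFinD -EFinM; congr EFin; lra.
Qed.

(** The marginals and the squared cost depend affinely on the coupling. *)
Lemma midpoint_optimal mu nu g1 g2 :
  optimal_coupling mu nu g1 -> optimal_coupling mu nu g2 ->
  exists2 h, optimal_coupling mu nu h &
    forall A, h A = 2^-1%:E * (g1 A + g2 A).
Proof.
move=> og1 og2; have [h [hE hI]] := midpoint_probability g1 g2.
have [[g1mu g1nu] _] := og1; have [[g2mu g2nu] _] := og2.
exists h => //; split.
  split=> A mA; rewrite /pushforward hE.
    rewrite -[g1 _]/(pushforward g1 fst A) -[g2 _]/(pushforward g2 fst A).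
    by rewrite -g1mu// -g2mu// mule_half2.
  rewrite -[g1 _]/(pushforward g1 snd A) -[g2 _]/(pushforward g2 snd A).
  by rewrite -g1nu// -g2nu// mule_half2.
apply: sqre_inj; [exact: transport_cost_ge0|exact: W2_ge0|].
rewrite transport_cost_sqr hI; last 2 first.
- exact: measurable_sqdist.
- exact: sqdist_ge0.
rewrite -(W2_sqr_optimal og1) -(W2_sqr_optimal og2) mule_half2//.
by rewrite expe2 mule_ge0// W2_ge0.
Qed.

Lemma optimal_coupling_unique mu nu g1 g2 (A : set (V * V)) :
  mu `<< lebesgue_outer ->
  optimal_coupling mu nu g1 -> optimal_coupling mu nu g2 ->
  measurable A -> g1 A = g2 A.
Proof.
move=> ac og1 og2 mA; have [h oh hE] := midpoint_optimal og1 og2.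
have [T mT hT] := optimal_coupling_graph ac oh.
have mI : measurable_fun setT (fun x => (x, T x)) by exact: measurable_fun_pair.
pose B := (fun x => (x, T x)) @^-1` A.
have mB : measurable B by rewrite -[X in measurable X]setTI; exact: mI.
have mB1 : measurable (fst @^-1` B : set (V * V)).
  by rewrite -[X in measurable X]setTI; exact: measurable_fst.
(* [A] and the cylinder over [B] disagree exactly on [Z], which misses the graph of [T]. As [h] is
   the mean of [g1] and [g2], both give [Z] mass 0. *)
pose Z := (A `\` fst @^-1` B) `|` (fst @^-1` B `\` A).
have mZ : measurable Z by apply: measurableU; exact: measurableD.
have hZ : h Z = 0.
  rewrite hT// /pushforward (_ : _ @^-1` Z = set0) ?measure0//.
  by rewrite -subset0 => x [[]|[]].
have gmu g : optimal_coupling mu nu g -> g Z = 0 -> g A = mu B.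
  move=> [[gmu _] _] gZ; rewrite gmu// /pushforward.
  apply/eqP; rewrite eq_le; apply/andP; split.
    apply: (le_measure_off_null mA mB1 mZ gZ) => z [Az zZ].
    by apply: contrapT => zB; apply: zZ; left.
  apply: (le_measure_off_null mB1 mA mZ gZ) => z [Bz zZ].
  by apply: contrapT => zA; apply: zZ; right.
move: hZ; rewrite hE => /eqP; rewrite mule_eq0 eqe invr_eq0 pnatr_eq0/=.
rewrite padde_eq0// => /andP[/eqP g1Z /eqP g2Z].
by rewrite (gmu g1)// (gmu g2).
Qed.

(** The chosen map induces some optimal coupling, which by uniqueness agrees with [g] on Borel
    sets. *)
Lemma transport_map_optimal mu nu g :
  mu `<< lebesgue_outer -> optimal_coupling mu nu g ->
  measurable_fun setT (transport_map mu nu) /\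
  is_pushforward mu (fun x => (x, transport_map mu nu x)) g.
Proof.
move=> ac og; have [T mT gT] := optimal_coupling_graph ac og.
have : is_optimal_map mu nu (transport_map mu nu).
  by apply: (@xgetPex _ _ [set T | is_optimal_map mu nu T]); exists T; split=> //; exists g.
move=> [mt [g' og' g't]]; split=> // A mA.
by rewrite (optimal_coupling_unique ac og og')// g't.
Qed.

End uniqueness.

(** * Integrals of squares of vector fields *)

Section quadratic_expansion.
Context {R : realType} {d : nat}.
Local Notation V := 'rV[R]_d.
Local Open Scope ereal_scope.
Context (m : probability V R).
Implicit Types u v : V -> V.

Lemma inner_AMGM (x y : V) : (`|inner x y| <= inner x x + inner y y)%R.
Proof.
have := inner_ge0 (x + y); have := inner_ge0 (x - y).
rewrite !(innerBl, innerBr, innerDl, innerDr) (innerC y x).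
have := inner_ge0 x; have := inner_ge0 y.
by move=> ? ? ? ?; rewrite ler_norml; apply/andP; split; lra.
Qed.

Lemma integrable_sqr u : measurable_fun setT u ->
  \int[m]_x (inner (u x) (u x))%:E < +oo ->
  m.-integrable setT (fun x => (inner (u x) (u x))%:E).
Proof.
move=> mu uoo; apply/integrableP; split.
  by apply/measurable_EFinP; exact: measurable_inner.
by under eq_integral do rewrite gee0_abs ?lee_fin ?inner_ge0//.
Qed.

Lemma integrable_inner u v : measurable_fun setT u -> measurable_fun setT v ->
  \int[m]_x (inner (u x) (u x))%:E < +oo ->
  \int[m]_x (inner (v x) (v x))%:E < +oo ->
  m.-integrable setT (fun x => (inner (u x) (v x))%:E).
Proof.
move=> mu mv uoo voo.
apply: (le_integrable _ _ _ (integrableD _ (integrable_sqr mu uoo) (integrable_sqr mv voo))) => //.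
  by apply/measurable_EFinP; exact: measurable_inner.
move=> x _; rewrite /= lee_fin.
by apply: (le_trans (inner_AMGM _ _)); exact: ler_norm.
Qed.

Lemma integral_sqr_expand u v (t : R) :
  measurable_fun setT u -> measurable_fun setT v ->
  \int[m]_x (inner (u x) (u x))%:E < +oo ->
  \int[m]_x (inner (v x) (v x))%:E < +oo ->
  \int[m]_x (inner (u x - t *: v x) (u x - t *: v x))%:E =
  \int[m]_x (inner (u x) (u x))%:E +
  ((- (2 * t))%:E * \int[m]_x (inner (u x) (v x))%:E +
   (t ^+ 2)%:E * \int[m]_x (inner (v x) (v x))%:E).
Proof.
move=> mu mv uoo voo.
have iu := integrable_sqr mu uoo; have iv := integrable_sqr mv voo.
have iuv := integrable_inner mu mv uoo voo.
rewrite -(integralZl _ iuv)// -(integralZl _ iv)//.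
rewrite -integralD//; [|exact: integrableZl|exact: integrableZl].
rewrite -integralD//; last by apply: integrableD => //; exact: integrableZl.
apply: eq_integral => x _; rewrite -!EFinM -!EFinD; congr EFin.
rewrite !(innerBl, innerBr, innerZl, innerZr) (innerC (v x) (u x)).
by ring.
Qed.

End quadratic_expansion.

Lemma L2norm_sqr {R : realType} {d : nat} (mu : P2 R d) (xi : 'rV[R]_d -> 'rV[R]_d) :
  (L2norm mu xi ^+ 2 = \int[mu]_x (inner (xi x) (xi x))%:E)%E.
Proof.
have sqrE (x : \bar R) : (0 <= x -> x ^+ 2 = x `^ 2)%E.
  case: x => [r r0|_|//]; last by rewrite poweRyr// expe2 mulyy.
  by rewrite poweR_EFin powR_mulrn// EFin_expe.
rewrite sqrE ?Lnorm_ge0// poweR_Lnorm//; apply: eq_integral => x _.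
by rewrite -sqrE// gee0_abs ?lee_fin ?sqrtr_ge0// -EFin_expe enorm_sqr.
Qed.

(** * Wasserstein estimates and the first-order condition *)

Section prox_subdifferential.
Context {R : realType} {d : nat}.
Local Notation V := 'rV[R]_d.
Local Open Scope ereal_scope.
Implicit Types (mu nu rho : P2 R d) (g : probability (V * V)%type R).

(** Existence of optimal couplings is read off the geodesics that convexity provides. *)
Lemma geodesically_convex_coupling (Phi : P2 R d -> \bar R) mu nu :
  geodesically_convex Phi -> exists g, optimal_coupling mu nu g.
Proof. by move=> /(_ mu nu)[c [g og _] _]; exists g. Qed.

Lemma W2_sqr_lty mu nu g : optimal_coupling mu nu g -> W2 mu nu ^+ 2 < +oo.
Proof.
by move=> og; rewrite (W2_sqr_optimal og); exact: coupling_cost_lty og.1.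
Qed.

Lemma W2_sqr_ge0 mu nu : 0 <= W2 mu nu ^+ 2.
Proof. by rewrite expe2 mule_ge0// W2_ge0. Qed.

(** The law of [(S, T)] under [rho] is a coupling of the two images. *)
Lemma coupling_maps rho mu1 mu2 (S T : V -> V) :
  measurable_fun setT S -> measurable_fun setT T ->
  is_pushforward rho S mu1 -> is_pushforward rho T mu2 ->
  W2 mu1 mu2 ^+ 2 <= \int[rho]_x (inner (S x - T x) (S x - T x))%:E.
Proof.
move=> mS mT rS rT.
have mST : measurable_fun setT (fun x => (S x, T x)) by exact: measurable_fun_pair.
have [k kE] := pushforward_probability rho mST.
have ck : coupling mu1 mu2 k.
  split=> A mA.
    rewrite rS// /pushforward kE// -[X in measurable X]setTI.
    exact: measurable_fst.
  rewrite rT// /pushforward kE// -[X in measurable X]setTI.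
  exact: measurable_snd.
apply: (le_trans (W2_sqr_le ck)).
rewrite (ge0_integral_is_pushforward mST kE measurable_sqdist)//.
exact: sqdist_ge0.
Qed.

Lemma W2_sym mu nu : W2 mu nu = W2 nu mu.
Proof.
have le_swap mu1 mu2 : W2 mu1 mu2 <= W2 mu2 mu1.
  apply/ereal_infP => _ [g [g2 g1] <-].
  have ms : measurable_fun setT (fun z : V * V => (z.2, z.1)).
    exact: measurable_fun_pair.
  have [k kE] := pushforward_probability g ms.
  apply: ge_ereal_inf; exists (transport_cost k).
    exists k => //; split=> A mA.
      rewrite g1// /pushforward kE// -[X in measurable X]setTI.
      exact: measurable_fst.
    rewrite g2// /pushforward kE// -[X in measurable X]setTI.
    exact: measurable_snd.
  rewrite (_ : transport_cost k = transport_cost g)//.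
  apply: sqre_inj; [exact: transport_cost_ge0|exact: transport_cost_ge0|].
  rewrite !transport_cost_sqr.
  rewrite (ge0_integral_is_pushforward ms kE measurable_sqdist sqdist_ge0).
  apply: eq_integral => z _; rewrite /sqdist/= -opprB innerNl.
  by rewrite (innerC (z.1 - z.2)) innerNl opprK.
by apply/eqP; rewrite eq_le !le_swap.
Qed.

Lemma W2_sqr_map mu nu g (T : V -> V) : measurable_fun setT T ->
  optimal_coupling mu nu g -> is_pushforward mu (fun x => (x, T x)) g ->
  W2 mu nu ^+ 2 = \int[mu]_x (inner (T x - x) (T x - x))%:E.
Proof.
move=> mT og gT; have mI : measurable_fun setT (fun x => (x, T x)).
  exact: measurable_fun_pair.
rewrite (W2_sqr_optimal og).
rewrite (ge0_integral_is_pushforward mI gT measurable_sqdist sqdist_ge0).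
apply: eq_integral => x _ /=; rewrite /sqdist /= -(opprB x) innerNl.
by rewrite (innerC (x - T x)) innerNl opprK.
Qed.

Lemma is_pushforward_snd_map mu nu g (T : V -> V) : coupling mu nu g ->
  is_pushforward mu (fun x => (x, T x)) g -> is_pushforward mu T nu.
Proof.
move=> [_ gnu] gT A mA; rewrite gnu// /pushforward gT// -[X in measurable X]setTI.
exact: measurable_snd.
Qed.

(** As [g] is carried by the graph of [S], [c t] is the image of [mu] under [(1 - t) id + t S];
    pairing this map with [T] gives a competitor for the distance. *)
Lemma W2_geodesic_le mu rho g (c : R -> P2 R d) (t : R) (S T : V -> V) :
  measurable_fun setT S -> measurable_fun setT T ->
  is_pushforward mu (fun x => (x, S x)) g ->
  is_pushforward mu T rho ->
  is_pushforward g (fun z => (1 - t) *: z.1 + t *: z.2)%R (c t) ->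
  W2 (c t) rho ^+ 2 <=
  \int[mu]_x (inner ((T x - x) - t *: (S x - x)) ((T x - x) - t *: (S x - x)))%:E.
Proof.
move=> mS mT gS muT ct.
have mSt : measurable_fun setT (fun x : V => (1 - t) *: x + t *: S x)%R.
  by apply: measurable_addrV; exact: measurable_scalerV.
have muSt : is_pushforward mu (fun x : V => (1 - t) *: x + t *: S x)%R (c t).
  move=> A mA; rewrite ct// /pushforward gS//.
  rewrite -[X in measurable X]setTI.
  suff : measurable_fun setT (fun z : V * V => (1 - t) *: z.1 + t *: z.2)%R by exact.
  by apply: measurable_addrV; exact: measurable_scalerV.
apply: (le_trans (coupling_maps mSt mT muSt muT)).
rewrite le_eqVlt; apply/orP; left; apply/eqP; apply: eq_integral => x _.
have -> : ((1 - t) *: x + t *: S x - T x = - (T x - x - t *: (S x - x)))%R.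
  by apply/rowP => i; rewrite !mxE; ring.
by rewrite innerNl innerC innerNl opprK.
Qed.

(** [p] and [n] stand for [Phi] at the minimizer and at the competitor, and [U], [I], [B] for the
    integrals of [|u|^2], [<u, v>], [|v|^2], with [u] and [v] the displacements to [mu] and to the
    competitor. Cancelling and dividing by [t > 0] leaves the error [t B / (2 tau)]. *)
Lemma first_order_condition (p n U I B tau : R) : (0 < tau)%R -> (0 <= B)%R ->
  (forall t : R, (0 <= t <= 1)%R -> (p + (2 * tau)^-1 * U <=
    (1 - t) * p + t * n + (2 * tau)^-1 * (U + (- (2 * t) * I + t ^+ 2 * B)))%R) ->
  (p + tau^-1 * I <= n)%R.
Proof.
move=> tau0 B0 H; apply/ler_addgt0Pr => e e0.
have k0 : (0 < (2 * tau)^-1)%R by rewrite invr_gt0 mulr_gt0.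
have -> : (tau^-1 = 2 * (2 * tau)^-1)%R by rewrite invfM mulrA divff ?mul1r.
move: k0 H; move: ((2 * tau)^-1)%R => k k0 H.
(* Chosen to make the error [t * (k * B)] at most [e]; the [+ 1] keeps the denominator positive when
   [B] vanishes. *)
pose t : R := Num.min 1%R (e / (k * B + 1))%R.
have kB0 : (0 < k * B + 1)%R by rewrite ltr_wpDl// mulr_ge0// ltW.
have t0 : (0 < t)%R by rewrite lt_min ltr01 divr_gt0.
have t1 : (t <= 1)%R by rewrite ge_min lexx.
have te : (t * (k * B) <= e)%R.
  apply: (@le_trans _ _ (t * (k * B + 1))%R); first by rewrite ler_pM2l// lerDl.
  by rewrite -ler_pdivlMr// ge_min lexx orbT.
have := H t; rewrite (ltW t0) t1 => /(_ isT) {}H.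
rewrite -(ler_pM2l t0) -subr_ge0.
have slack : (0 <= t * (e - t * (k * B)))%R by rewrite mulr_ge0 ?subr_ge0// ltW.
move: H; rewrite -subr_ge0 => H; apply: (le_trans (addr_ge0 H slack)).
by rewrite le_eqVlt; apply/orP; left; apply/eqP; ring.
Qed.

End prox_subdifferential.

(** * The proximal point and its subgradient *)

Section prox.
Context {R : realType} {d : nat}.
Local Notation V := 'rV[R]_d.
Local Open Scope ereal_scope.
Context (Phi : P2 R d -> \bar R)
  (Phi_gtNy : forall mu : P2 R d, -oo < Phi mu)
  (Phi_convex : geodesically_convex Phi)
  (Phi_ac : forall mu : P2 R d, dom Phi mu -> mu `<< lebesgue_outer)
  (mu muhat : P2 R d) (tau : R) (tau_gt0 : (0 < tau)%R)
  (muhat_prox : prox Phi tau mu muhat).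

Let k0 : 0 <= (2 * tau)^-1%:E.
Proof. by rewrite lee_fin invr_ge0 mulr_ge0// ltW. Qed.

(** A point of the domain lies at finite distance from [mu], so the minimal energy, which bounds
    [Phi muhat], is below [+oo]. *)
Lemma prox_dom : dom Phi !=set0 -> dom Phi muhat.
Proof.
move=> [rho rhoD]; rewrite /dom/=.
have [g og] := geodesically_convex_coupling rho mu Phi_convex.
apply: (@le_lt_trans _ _ (prox_energy Phi tau mu muhat)).
  by rewrite leeDl// mule_ge0// W2_sqr_ge0.
apply: (le_lt_trans (muhat_prox rho)); rewrite /prox_energy lte_add_pinfty//.
by rewrite lte_mul_pinfty// (W2_sqr_lty og).
Qed.

Context (muhat_dom : dom Phi muhat) (xi : V -> V) (xi_L2 : L2 muhat xi)
  (map_xi : {ae muhat, forall x,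
    transport_map muhat mu x = (x + tau *: xi x)%R}).

Lemma W2_sqr_prox : W2 muhat mu ^+ 2 = (tau ^+ 2)%:E * L2norm muhat xi ^+ 2.
Proof.
have [g og] := geodesically_convex_coupling muhat mu Phi_convex.
have [mT gT] := transport_map_optimal (Phi_ac muhat_dom) og.
have mu2 : measurable_fun setT (fun x => transport_map muhat mu x - x)%R.
  exact: measurable_subrV.
rewrite (W2_sqr_map mT og gT) L2norm_sqr -ge0_integralZl//; last 3 first.
- by apply/measurable_EFinP; apply: measurable_inner; exact: xi_L2.1.
- by move=> x _; rewrite lee_fin inner_ge0.
- by rewrite lee_fin sqr_ge0.
apply: ae_eq_integral => //.
- by apply/measurable_EFinP; exact: measurable_inner.
- apply/measurable_EFinP; apply: (measurableT_comp (mulrl_measurable _)).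
  by apply: measurable_inner; exact: xi_L2.1.
apply: filterS map_xi => x Tx _.
by rewrite Tx addrC addKr innerZl innerZr mulrA -expr2 EFinM.
Qed.

Lemma prox_subdifferential : subdifferential Phi muhat xi.
Proof.
split=> // nu nuD.
have [g0 og0] := geodesically_convex_coupling muhat mu Phi_convex.
have [mT gT] := transport_map_optimal (Phi_ac muhat_dom) og0.
have [c [g og gc] cconv] := Phi_convex muhat nu.
have [mS gS] := transport_map_optimal (Phi_ac muhat_dom) og.
set T := transport_map muhat mu in mT gT *.
set S := transport_map muhat nu in mS gS *.
pose u x := (T x - x)%R; pose v x := (S x - x)%R.
have mu' : measurable_fun setT u by exact: measurable_subrV.
have mv : measurable_fun setT v by exact: measurable_subrV.
have Uoo : \int[muhat]_x (inner (u x) (u x))%:E < +oo.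
  by rewrite -(W2_sqr_map mT og0 gT) (W2_sqr_lty og0).
have Boo : \int[muhat]_x (inner (v x) (v x))%:E < +oo.
  by rewrite -(W2_sqr_map mS og gS) (W2_sqr_lty og).
have sqr0 (w : V -> V) : 0 <= \int[muhat]_x (inner (w x) (w x) : R)%:E.
  by apply: integral_ge0 => x _; rewrite lee_fin inner_ge0.
have finU := integrable_fin_num measurableT (integrable_sqr mu' Uoo).
have finB := integrable_fin_num measurableT (integrable_sqr mv Boo).
have iuv := integrable_inner mu' mv Uoo Boo.
have finI := integrable_fin_num measurableT iuv.
have -> : \int[muhat]_x (inner (xi x) (v x))%:E =
    (tau^-1)%:E * \int[muhat]_x (inner (u x) (v x))%:E.
  rewrite -(integralZl measurableT iuv).
  apply: ae_eq_integral => //.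
  - by apply/measurable_EFinP; apply: measurable_inner => //; exact: xi_L2.1.
  - apply/measurable_EFinP; apply: (measurableT_comp (mulrl_measurable _)).
    exact: measurable_inner.
  apply: filterS map_xi => x Tx _; rewrite -EFinM; congr EFin.
  by rewrite /u /T Tx addrC addKr innerZl mulrA mulVf ?mul1r// gt_eqF.
have U0 := sqr0 u; have B0 := sqr0 v.
have finP : Phi muhat \is a fin_num by rewrite fin_numE gt_eqF// lt_eqF.
have finN : Phi nu \is a fin_num by rewrite fin_numE gt_eqF// lt_eqF.
have ineq (t : R) : (0 <= t <= 1)%R ->
    Phi muhat + (2 * tau)^-1%:E * \int[muhat]_x (inner (u x) (u x))%:E <=
    (1 - t)%:E * Phi muhat + t%:E * Phi nu + (2 * tau)^-1%:E *
    (\int[muhat]_x (inner (u x) (u x))%:E +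
     ((- (2 * t))%:E * \int[muhat]_x (inner (u x) (v x))%:E +
      (t ^+ 2)%:E * \int[muhat]_x (inner (v x) (v x))%:E)).
  (* Minimality is tested against [c t]; convexity bounds [Phi (c t)], and transport from [muhat]
     bounds the distance term. *)
  move=> t01; rewrite -[X in _ + _ * X <= _](W2_sqr_map mT og0 gT).
  apply: (le_trans (muhat_prox (c t))); rewrite /prox_energy leeD ?cconv//.
  rewrite lee_pmul2l//; last by rewrite lte_fin invr_gt0 mulr_gt0.
  rewrite -(integral_sqr_expand t mu' mv Uoo Boo).
  have muT := is_pushforward_snd_map og0.1 gT.
  exact: (W2_geodesic_le mS mT gS muT (gc t t01)).
(* All quantities being finite, the inequality is passed to real numbers. *)
move: ineq finU finB finI finP finN U0 B0.
move: (\int[_]_x _) (\int[_]_x _) (\int[_]_x _) (Phi muhat) (Phi nu).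
move=> [B||]// [I||]// [U||]// [p||]// [n||]// ineq _ _ _ _ _ _.
rewrite lee_fin => B0. rewrite -EFinM -EFinD lee_fin.
exact: (first_order_condition tau_gt0 B0 ineq).
Qed.

End prox.

(** * The quantitative estimates, from the subgradient inequality at [mu] *)

Local Open Scope ereal_scope.

Theorem theorem3p1 (R : realType) (d : nat) (Phi : P2 R d -> \bar R)
  (Phi_ext : forall mu nu : P2 R d, measure_eq mu nu -> Phi mu = Phi nu)
  (Phi_gtNy : forall mu : P2 R d, -oo < Phi mu)
  (Phi_proper : dom Phi !=set0)
  (Phi_convex : geodesically_convex Phi)
  (Phi_bounded : exists m : R, forall mu : P2 R d, m%:E <= Phi mu)
  (Phi_ac : forall mu : P2 R d, dom Phi mu -> mu `<< lebesgue_outer)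
  (mu : P2 R d) (eps : R) (eps_gt0 : (0 < eps)%R)
  (mu_eps : Phi mu <= ereal_inf [set Phi nu | nu in setT] + eps%:E)
  (lambda : R) (lambda_gt0 : (0 < lambda)%R)
  (muhat : P2 R d) (xi : 'rV[R]_d -> 'rV[R]_d) (xi_L2 : L2 muhat xi)
  (muhat_prox : prox Phi (lambda ^+ 2 / eps) mu muhat)
  (map_xi : {ae muhat, forall x,
     transport_map muhat mu x = (x + (lambda ^+ 2 / eps) *: xi x)%R}) :
  [/\ W2 mu muhat <= lambda%:E,
      Phi muhat + (lambda ^+ 2 / (2 * eps))%:E * L2norm muhat xi ^+ 2 <= Phi mu,
      subdifferential Phi muhat xi &
      L2norm muhat xi <= (eps / lambda)%:E].
Proof.
set tau := (lambda ^+ 2 / eps)%R.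
have tau0 : (0 < tau)%R by rewrite divr_gt0// exprn_gt0.
have muhat_dom : dom Phi muhat := prox_dom Phi_convex tau0 muhat_prox Phi_proper.
have mu_le : Phi mu <= Phi muhat + eps%:E.
  by apply: (le_trans mu_eps); rewrite leeD2r// ereal_inf_lbound//; exists muhat.
have mu_dom : dom Phi mu by apply: (le_lt_trans mu_le); rewrite lte_add_pinfty ?ltry.
have sub := prox_subdifferential Phi_gtNy Phi_convex Phi_ac tau0 muhat_prox
  muhat_dom xi_L2 map_xi.
have W2E := W2_sqr_prox Phi_convex Phi_ac muhat_dom xi_L2 map_xi.
have N0 : 0 <= L2norm muhat xi by exact: Lnorm_ge0.
have pairing : \int[muhat]_x (inner (xi x) (transport_map muhat mu x - x))%:E =
    tau%:E * L2norm muhat xi ^+ 2.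
  have [g og] := geodesically_convex_coupling muhat mu Phi_convex.
  have [mT gT] := transport_map_optimal (Phi_ac _ muhat_dom) og.
  rewrite L2norm_sqr -ge0_integralZl//; last 3 first.
  - by apply/measurable_EFinP; apply: measurable_inner; exact: xi_L2.1.
  - by move=> x _; rewrite lee_fin inner_ge0.
  - by rewrite lee_fin ltW.
  apply: ae_eq_integral => //.
  - apply/measurable_EFinP; apply: measurable_inner; first exact: xi_L2.1.
    exact: measurable_subrV.
  - apply/measurable_EFinP; apply: (measurableT_comp (mulrl_measurable _)).
    by apply: measurable_inner; exact: xi_L2.1.
  by apply: filterS map_xi => x Tx _; rewrite Tx addrC addKr innerZr EFinM.
(* This energy estimate has the coefficient [tau], twice the one required in (b). *)
have [_ _ /(_ mu mu_dom)] := sub; rewrite pairing => energy.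
have finP : Phi muhat \is a fin_num by rewrite fin_numE gt_eqF// lt_eqF.
have finM : Phi mu \is a fin_num by rewrite fin_numE gt_eqF// lt_eqF.
have finN : L2norm muhat xi \is a fin_num by rewrite ge0_fin_numE// xi_L2.2.
move: finP finM finN N0 W2E mu_le energy.
case: (L2norm muhat xi) => [N||]//; case: (Phi muhat) => [p||]//.
case: (Phi mu) => [q||]// _ _ _; rewrite lee_fin => N0.
rewrite -!EFin_expe -!EFinM -!EFinD !lee_fin => W2E mu_le energy.
(* [Phi mu - Phi muhat] is at least [tau * N ^+ 2] and at most [eps]. *)
have tN : (tau * N ^+ 2 <= eps)%R by lra.
have sN : (N ^+ 2 <= (eps / lambda) ^+ 2)%R.
  rewrite expr_div_n -(ler_pM2l tau0); apply: (le_trans tN).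
  rewrite /tau le_eqVlt; apply/orP; left; apply/eqP; field.
  by rewrite !gt_eqF.
split=> //.
(* The squared distance is [tau * (tau * N ^+ 2) <= tau * eps = lambda ^+ 2]. *)
- rewrite -lee_sqr ?W2_ge0 ?lee_fin ?(ltW lambda_gt0)//.
  rewrite W2_sym W2E -EFin_expe lee_fin -/tau.
  rewrite (_ : tau ^+ 2 * N ^+ 2 = tau * (tau * N ^+ 2))%R; last by ring.
  apply: (@le_trans _ _ (tau * eps)%R); first by rewrite ler_pM2l.
  by rewrite /tau divfK// gt_eqF.
- apply: (le_trans _ energy); rewrite lerD2l ler_wpM2r ?sqr_ge0// /tau invfM.
  rewrite mulrA mulrAC ler_piMr ?ltW//; lra.
- by rewrite -(ler_sqr N0) ?nnegrE// divr_ge0 ?ltW.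
Qed.
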